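(* Let $(\mathcal{M},g)$ be an $n$-dimensional spacetime, $n\ge 3$, admitting a semi-symmetric metric connection $\nabla$ with unit time-like associated vector field $v$ (so $v^iv_i=-1$), whose curvature tensor $\overline{R}$ vanishes identically. If $v$ is a torqued vector field, i.e. $\nabla_kv_h=f\,g_{kh}+\omega_kv_h$ and $\omega_kv^k=0$ for a real constant $f$ and a 1-form $\omega$, then $\mathcal{M}$ is a perfect fluid spacetime.
   Context: A spacetime is a connected time-oriented Lorentzian manifold $(\mathcal{M},g)$. $\mathrm{D}$ denotes the Levi-Civita connection of $g$, and $R_{hk}$ the Ricci tensor of $\mathrm{D}$. A semi-symmetric metric connection on $\mathcal{M}$ with associated vector field $v$ is a linear connection $\nabla$ with $\nabla g=0$ whose torsion $T(U,V)=\nabla_UV-\nabla_VU-[U,V]$ satisfies $T(U,V)=\pi(V)U-\pi(U)V$, where $\pi(U)=g(U,v)$; equivalently $\nabla_UV=\mathrm{D}_UV+\pi(V)U-g(U,V)v$. Write $v_h=g_{hk}v^k$. $\overline{R}$ is the curvature tensor of the connection $\nabla$. In the torqued condition, $\nabla$ is the semi-symmetric metric connection; $\omega$ is called the torqued form of $v$. Perfect fluid spacetime: a spacetime is called a perfect fluid spacetime if its non-vanishing Ricci tensor satisfies $R_{hk}=\alpha g_{hk}+\beta w_hw_k$ for some smooth functions $\alpha,\beta$ on $\mathcal{M}$ and a vector field $w$ (the velocity vector) with $g_{hk}w^hw^k=-1$, $w_h=g_{hk}w^k$. *)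

(* Defs.v *)
From mathcomp Require Import all_boot all_order all_algebra.
From mathcomp Require Import all_classical all_reals all_analysis.
From mathcomp Require Import ring.

Set Implicit Arguments.
Unset Strict Implicit.
Unset Printing Implicit Defensive.

Import Order.TTheory GRing.Theory Num.Theory.
Import numFieldNormedType.Exports.

Local Open Scope classical_set_scope.
Local Open Scope ring_scope.

(** * Smooth real functions on open subsets of R^n *)

Section SmoothOn.
Variables (R : realType) (n : nat).

Fixpoint Ck (k : nat) (D : set 'rV[R]_n) (f : 'rV[R]_n -> R) : Prop :=
  match k with
  | 0 => forall x, D x -> {for x, continuous f}
  | k'.+1 => (forall (i : 'I_n) x, D x -> derivable f x 'e_i) /\
             (forall i : 'I_n, Ck k' D (fun x => 'D_'e_i f x))
  end.

Definition smooth_on (D : set 'rV[R]_n) (f : 'rV[R]_n -> R) : Prop :=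
  forall k, Ck k D f.

End SmoothOn.

(** * Smooth manifolds *)

(* [point] is total; only its values on the image of [dom] are meaningful. *)
Record chart (R : realType) (n : nat) (T : topologicalType) := Chart {
  dom : set T;
  coord : T -> 'rV[R]_n;
  point : 'rV[R]_n -> T;
  dom_open : open dom;
  img_open : open (coord @` dom);
  coordK : forall p, dom p -> point (coord p) = p;
  coord_continuous : forall p, dom p -> {for p, continuous coord};
  point_continuous : forall p, dom p -> {for coord p, continuous point} }.

(* The atlas need not be maximal: smoothness and tensor fields are the same for
   an atlas and for the maximal atlas that contains it. *)
Record manifold (R : realType) (n : nat) := Manifold {
  carrier :> topologicalType;
  carrier_hausdorff : hausdorff_space carrier;
  carrier_second_countable : @second_countable carrier;
  index : Type;
  atlas : index -> chart R n carrier;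
  atlas_cover : forall p : carrier, exists i, dom (atlas i) p;
  atlas_smooth : forall i j (a : 'I_n),
    smooth_on (coord (atlas i) @` (dom (atlas i) `&` dom (atlas j)))
      (fun x => coord (atlas j) (point (atlas i) x) 0 a) }.

Section Fields.
Variables (R : realType) (n : nat) (M : manifold R n).
Implicit Types (i j : index M) (p : M) (a b c d e : 'I_n).

Definition at_chart i p : Prop := dom (atlas i) p.

(* The partial derivative of F with respect to the k-th coordinate of chart i. *)
Definition pd i (k : 'I_n) (F : M -> R) p : R :=
  'D_'e_k (F \o point (atlas i)) (coord (atlas i) p).

Definition chart_smooth i (F : M -> R) : Prop :=
  smooth_on (coord (atlas i) @` dom (atlas i)) (F \o point (atlas i)).

Definition smooth_fun (F : M -> R) : Prop := forall i, chart_smooth i F.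

(* With x the coordinates of chart i and y those of chart j:
   jac i j p a b = dy^a/dx^b, hess i j p a b c = d^2 y^a/dx^b dx^c. *)
Definition jac i j p a b : R := pd i b (fun q => coord (atlas j) q 0 a) p.

Definition hess i j p a b c : R := pd i b (fun q => jac i j q a c) p.

(* Tensor fields and connections are given by their components in every chart
   of the atlas, subject to the usual change-of-coordinates rule; components
   in chart i are meaningful at the points of that chart only. *)
Record vector_field := VectorField {
  vf_comp :> index M -> M -> 'I_n -> R;
  vf_smooth : forall i a, chart_smooth i (fun p => vf_comp i p a);
  vf_law : forall i j p a, at_chart i p -> at_chart j p ->
    vf_comp j p a = \sum_b jac i j p a b * vf_comp i p b }.

Record one_form := OneForm {
  of_comp :> index M -> M -> 'I_n -> R;
  of_smooth : forall i a, chart_smooth i (fun p => of_comp i p a);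
  of_law : forall i j p b, at_chart i p -> at_chart j p ->
    of_comp i p b = \sum_a jac i j p a b * of_comp j p a }.

(* lc_comp i p a b c is the coefficient Gamma^a_{bc} defined by
   nabla_{d_b} d_c = Gamma^a_{bc} d_a. *)
Record linear_connection := LinearConnection {
  lc_comp :> index M -> M -> 'I_n -> 'I_n -> 'I_n -> R;
  lc_smooth : forall i a b c, chart_smooth i (fun p => lc_comp i p a b c);
  lc_law : forall i j p a b c, at_chart i p -> at_chart j p ->
    \sum_d jac i j p a d * lc_comp i p d b c =
    hess i j p a b c +
    \sum_d \sum_e lc_comp j p a d e * jac i j p d b * jac i j p e c }.

(* The Gram matrix of an orthonormal frame, of signature (-,+,...,+). *)
Definition minkowski : 'M[R]_n :=
  diag_mx (\row_a (if val a == 0%N then -1 else 1)).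

Record lorentz_metric := LorentzMetric {
  g_comp :> index M -> M -> 'M[R]_n;
  g_smooth : forall i a b, chart_smooth i (fun p => g_comp i p a b);
  g_law : forall i j p b d, at_chart i p -> at_chart j p ->
    g_comp i p b d =
    \sum_a \sum_c jac i j p a b * jac i j p c d * g_comp j p a c;
  g_sym : forall i p a b, at_chart i p -> g_comp i p a b = g_comp i p b a;
  g_lorentz : forall i p, at_chart i p ->
    exists2 E : 'M[R]_n, E \in unitmx & E *m g_comp i p *m E^T = minkowski }.

Section Coefficients.
Variable G : index M -> M -> 'I_n -> 'I_n -> 'I_n -> R.

(* torsion a b c is the d_a component of T(d_b, d_c). *)
Definition torsion i p a b c : R := G i p a b c - G i p a c b.

(* curvature a b c d is the d_a component of the curvature operator
   [nabla_{d_c}, nabla_{d_d}] applied to d_b. *)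
Definition curvature i p a b c d : R :=
  pd i c (fun q => G i q a d b) p - pd i d (fun q => G i q a c b) p
  + \sum_e (G i p a c e * G i p e d b - G i p a d e * G i p e c b).

Definition ricci i p b d : R := \sum_a curvature i p a b a d.

Definition flat : Prop :=
  forall i p a b c d, at_chart i p -> curvature i p a b c d = 0.

(* nabla_k u_h, for the components u of a covector field *)
Definition cov_deriv (u : index M -> M -> 'I_n -> R) i p (k h : 'I_n) : R :=
  pd i k (fun q => u i q h) p - \sum_a G i p a k h * u i p a.

Definition torsion_free : Prop :=
  forall i p a b c, at_chart i p -> torsion i p a b c = 0.

(* nabla_k g_{ab} = 0 *)
Definition metric_compatible (g : lorentz_metric) : Prop :=
  forall i p (k a b : 'I_n), at_chart i p ->
    pd i k (fun q => g i q a b) p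
    - \sum_c G i p c k a * g i p c b - \sum_c G i p c k b * g i p a c = 0.

End Coefficients.

Section Metric.
Variable g : lorentz_metric.

Definition lower (u : index M -> M -> 'I_n -> R) i p (h : 'I_n) : R :=
  \sum_k g i p h k * u i p k.

Definition sqnorm (u : index M -> M -> 'I_n -> R) i p : R :=
  \sum_h lower u i p h * u i p h.

Definition timelike (u : vector_field) : Prop :=
  forall i p, at_chart i p -> sqnorm u i p < 0.

Definition unit_timelike (u : vector_field) : Prop :=
  forall i p, at_chart i p -> sqnorm u i p = -1.

(* Christoffel symbols of g; [levi_civitaP] shows that they are the only
   torsion-free metric-compatible coefficients. *)
Definition levi_civita i p a b c : R :=
  2^-1 * \sum_d invmx (g i p) a d *
    (pd i b (fun q => g i q d c) p + pd i c (fun q => g i q b d) p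
     - pd i d (fun q => g i q b c) p).

End Metric.
End Fields.

Section LeviCivita.
Variables (R : realType) (n : nat) (M : manifold R n) (g : lorentz_metric M).
Implicit Types (i : index M) (p : M).

Lemma pd_ext i (k : 'I_n) (F H : M -> R) p : at_chart i p ->
  (forall q, at_chart i q -> F q = H q) -> pd i k F p = pd i k H p.
Proof.
move=> ip FH; apply: near_eq_derive.
have /open_nbhs_nbhs : open_nbhs (coord (atlas i) p)
    (coord (atlas i) @` dom (atlas i)).
  by split; [exact: img_open | exists p].
apply: filterS => _ [q iq <-] /=.
by rewrite coordK //; exact: FH.
Qed.

Lemma metric_unitmx i p : at_chart i p -> g i p \in unitmx.
Proof.
move=> ip; have [E E_unit eqE] := g_lorentz g ip.
have : minkowski R n \in unitmx.
  rewrite unitmxE det_diag unitfE; apply/prodf_neq0 => a _.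
  by rewrite mxE; case: ifP => _; rewrite ?oppr_eq0 oner_eq0.
by rewrite -eqE !unitmx_mul => /andP[/andP[]].
Qed.

Lemma levi_civitaP (G : index M -> M -> 'I_n -> 'I_n -> 'I_n -> R) :
  (torsion_free G /\ metric_compatible G g) <->
  (forall i p a b c, at_chart i p -> G i p a b c = levi_civita g i p a b c).
Proof.
have dgC i p (k a b : 'I_n) : at_chart i p ->
    pd i k (fun q => g i q a b) p = pd i k (fun q => g i q b a) p.
  by move=> ip; apply: pd_ext => // q iq; exact: g_sym.
have mulVg i p (x : 'I_n -> R) a : at_chart i p ->
    \sum_d invmx (g i p) a d * (\sum_e g i p d e * x e) = x a.
  move=> ip; transitivity
    ((invmx (g i p) *m (g i p *m (\col_e x e))) a 0).
    rewrite mxE; apply: eq_bigr => d _; rewrite mxE; congr (_ * _).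
    by apply: eq_bigr => e _; rewrite mxE.
  by rewrite mulKmx ?metric_unitmx// mxE.
have mulgV i p (x : 'I_n -> R) a : at_chart i p ->
    \sum_d g i p a d * (\sum_e invmx (g i p) d e * x e) = x a.
  move=> ip; transitivity
    ((g i p *m (invmx (g i p) *m (\col_e x e))) a 0).
    rewrite mxE; apply: eq_bigr => d _; rewrite mxE; congr (_ * _).
    by apply: eq_bigr => e _; rewrite mxE.
  by rewrite mulKVmx ?metric_unitmx// mxE.
split=> [[tf mc] i p a b c ip | GE].
  have GC d e h : G i p d e h = G i p d h e.
    by apply/eqP; rewrite -subr_eq0; apply/eqP; exact: tf.
  pose L d b c := \sum_a g i p d a * G i p a b c.
  have LC d e h : L d e h = L d h e by apply: eq_bigr => x _; rewrite GC.
  have dgE k x y : pd i k (fun q => g i q x y) p = L y k x + L x k y.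
    have := mc i p k x y ip; rewrite -addrA -opprD => /eqP.
    rewrite subr_eq0 => /eqP ->; congr (_ + _).
    by apply: eq_bigr => z _; rewrite mulrC g_sym.
    by apply: eq_bigr => z _; rewrite mulrC.
  rewrite /levi_civita -[LHS](mulVg i p (fun a => G i p a b c))// mulr_sumr.
  apply: eq_bigr => d _; rewrite mulrCA; congr (_ * _).
  rewrite !dgE (LC d c b) (LC c d b) (LC b d c) -/(L d b c).
  by field.
have LE i p d b c : at_chart i p -> \sum_a g i p d a * G i p a b c =
    2^-1 * (pd i b (fun q => g i q d c) p + pd i c (fun q => g i q b d) p
     - pd i d (fun q => g i q b c) p).
  move=> ip; transitivity (2^-1 * \sum_a g i p d a * \sum_e invmx (g i p) a e *
    (pd i b (fun q => g i q e c) p + pd i c (fun q => g i q b e) p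
     - pd i e (fun q => g i q b c) p)).
    by rewrite mulr_sumr; apply: eq_bigr => a _; rewrite GE// mulrCA.
  by congr (_ * _); exact: mulgV.
split=> [i p a b c ip | i p k a b ip].
  rewrite /torsion !GE// /levi_civita -mulrBr -sumrB big1 ?mulr0// => d _.
  rewrite (dgC i p c d b)// (dgC i p b c d)// (dgC i p d c b)//; ring.
have -> : \sum_c G i p c k a * g i p c b = \sum_c g i p b c * G i p c k a.
  by apply: eq_bigr => c _; rewrite mulrC g_sym.
have -> : \sum_c G i p c k b * g i p a c = \sum_c g i p a c * G i p c k b.
  by apply: eq_bigr => c _; rewrite mulrC.
rewrite !LE// (dgC i p k b a)// (dgC i p b k a)// (dgC i p a k b)//; by field.
Qed.

End LeviCivita.

(** * Spacetimes *)

(* The time orientation is represented by a smooth timelike vector field. *)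
Record spacetime (R : realType) (n : nat) := Spacetime {
  st_manifold :> manifold R n;
  st_connected : connected [set: st_manifold];
  metric : lorentz_metric st_manifold;
  time_orientation : vector_field st_manifold;
  time_orientation_timelike : timelike metric time_orientation }.

Section Spacetime.
Variables (R : realType) (n : nat) (M : spacetime R n).
Local Notation g := (metric M).

(* nabla g = 0 and T(U, V) = pi(V) U - pi(U) V with pi = g(., v) *)
Definition semi_symmetric_metric
    (nabla : linear_connection M) (v : vector_field M) : Prop :=
  metric_compatible nabla g /\
  forall i p a b c, at_chart i p ->
    torsion nabla i p a b c =
    lower g v i p c * (a == b)%:R - lower g v i p b * (a == c)%:R.

Definition torqued (nabla : linear_connection M) (v : vector_field M) : Prop :=
  exists (f : R) (omega : one_form M),
    (forall i p (k h : 'I_n), at_chart i p ->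
       cov_deriv nabla (lower g v) i p k h =
       f * g i p k h + omega i p k * lower g v i p h) /\
    (forall i p, at_chart i p -> \sum_k omega i p k * v i p k = 0).

Definition perfect_fluid : Prop :=
  (forall i p, at_chart i p ->
     exists h k, ricci (levi_civita g) i p h k != 0) /\
  exists (alpha beta : M -> R) (w : vector_field M),
    [/\ smooth_fun alpha, smooth_fun beta, unit_timelike g w &
      forall i p (h k : 'I_n), at_chart i p ->
        ricci (levi_civita g) i p h k =
        alpha p * g i p h k + beta p * lower g w i p h * lower g w i p k].

End Spacetime.

(* Main.v *)
From mathcomp Require Import all_boot all_order all_algebra.
From mathcomp Require Import all_classical all_reals all_analysis.
From mathcomp Require Import ring.
Require Import Defs.

Set Implicit Arguments.
Unset Strict Implicit.
Unset Printing Implicit Defensive.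

Import Order.TTheory GRing.Theory Num.Theory.
Import numFieldNormedType.Exports.

Local Open Scope classical_set_scope.
Local Open Scope ring_scope.

(** Write nabla for the flat connection, D for the Levi-Civita connection and
    pi = g(., v). The conclusion holds because g turns out to be a de Sitter
    metric: it has constant curvature 1, so that Ric = (n - 1) g and one can
    take alpha = n - 1, beta = 0 and w = v.

    Since nabla is metric and g(v, v) = -1, differentiating g(v, v) along
    nabla_k v_h = f g_kh + omega_k v_h gives f v_k = omega_k; contraction with
    v and omega(v) = 0 give f = 0, hence omega = 0. So the torqued field v is
    parallel for nabla ([unit_torqued_parallel]).

    The Levi-Civita connection is nabla minus the tensor
    S(X, Y) = pi(Y) X - g(X, Y) v, because subtracting S cancels the torsion
    and preserves metric compatibility ([levi_civita_semi_symmetric]). In the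
    curvature of D = nabla - S one then finds the curvature of nabla, the
    antisymmetrized derivative of S, and products of S. Each derivative of v
    or of g is expressed by the coefficients of nabla, as both are parallel,
    and everything but
      R(X, Y) Z = g(Y, Z) X - g(X, Z) Y
    cancels ([curvature_levi_civita_parallel]). The trace of the right-hand
    side is (n - 1) g, which vanishes nowhere. *)

(** * Calculus in a chart *)

Lemma sum_delta (R : pzRingType) (I : finType) (x : I -> R) (d : I) :
  \sum_e x e * (e == d)%:R = x d.
Proof.
rewrite (bigD1 d)//= eqxx mulr1 big1 ?addr0// => e /negPf ->.
by rewrite mulr0.
Qed.

Section PartialDerivatives.
Variables (R : realType) (n : nat) (M : manifold R n).
Implicit Types (i : index M) (p : M) (k : 'I_n) (F H : M -> R).

(** The sum and product rules for [pd] need the partial derivatives at one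
    point only. *)
Definition pderivable i F p : Prop :=
  forall k, derivable (F \o point (atlas i)) (coord (atlas i) p) 'e_k.

Lemma chart_smooth_pderivable i F p :
  at_chart i p -> chart_smooth i F -> pderivable i F p.
Proof. by move=> ip /(_ 1%N)[dF _] k; apply: dF; exists p. Qed.

Lemma smooth_cst (c : R) : smooth_fun (fun _ : M => c).
Proof.
move=> i k; rewrite /comp; elim: k c => [|k IH] c /=.
  by move=> x _; exact: cst_continuous.
split=> [j x _|j]; first exact: derivable_cst.
have -> : (fun x => 'D_'e_j (fun _ : 'rV[R]_n => c) x) = fun=> 0; last exact: IH.
by apply/funext => x; exact: derive_cst.
Qed.

Lemma pderivableM i F H p : pderivable i F p -> pderivable i H p ->
  pderivable i (fun q => F q * H q) p.
Proof. by move=> dF dH k; exact: (derivableM (dF k) (dH k)). Qed.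

Lemma pderivableB i F H p : pderivable i F p -> pderivable i H p ->
  pderivable i (fun q => F q - H q) p.
Proof. by move=> dF dH k; exact: (derivableB (dF k) (dH k)). Qed.

Lemma pderivable_cst i (c : R) p : pderivable i (fun=> c) p.
Proof. by move=> k; exact: derivable_cst. Qed.

Lemma comp_sum m (F : 'I_m -> M -> R) (h : 'rV[R]_n -> M) :
  (fun q => \sum_a F a q) \o h = \sum_a (F a \o h).
Proof. by apply/funext => x; rewrite fct_sumE. Qed.

Lemma pderivable_sum i m (F : 'I_m -> M -> R) p :
  (forall a, pderivable i (F a) p) -> pderivable i (fun q => \sum_a F a q) p.
Proof.
by move=> dF k; rewrite comp_sum; apply: derivable_sum => a; exact: dF.
Qed.

Lemma pdB i k F H p : pderivable i F p -> pderivable i H p ->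
  pd i k (fun q => F q - H q) p = pd i k F p - pd i k H p.
Proof. by move=> dF dH; exact: (deriveB (dF k) (dH k)). Qed.

Lemma pdM i k F H p : at_chart i p -> pderivable i F p -> pderivable i H p ->
  pd i k (fun q => F q * H q) p = pd i k F p * H p + F p * pd i k H p.
Proof.
move=> ip dF dH; rewrite /pd (deriveM (dF k) (dH k)) /= coordK//.
by rewrite addrC; congr (_ + _); rewrite -[LHS]/(_ * _) mulrC.
Qed.

Lemma pd_cst i k (c : R) p : pd i k (fun=> c) p = 0.
Proof. exact: derive_cst. Qed.

Lemma pd_sum i k m (F : 'I_m -> M -> R) p :
  (forall a, pderivable i (F a) p) ->
  pd i k (fun q => \sum_a F a q) p = \sum_a pd i k (F a) p.
Proof.
by move=> dF; rewrite /pd comp_sum derive_sum// => a; exact: dF.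
Qed.

End PartialDerivatives.

(** * Metric connections and unit torqued fields *)

Section Metric.
Variables (R : realType) (n : nat) (M : manifold R n) (g : lorentz_metric M).
Implicit Types (i : index M) (p : M) (a b c d e h k : 'I_n).

Lemma g_derivable i p a b :
  at_chart i p -> pderivable i (fun q => g i q a b) p.
Proof. by move=> ip; apply: chart_smooth_pderivable; last exact: g_smooth. Qed.

Lemma vf_derivable (v : vector_field M) i p a :
  at_chart i p -> pderivable i (fun q => v i q a) p.
Proof. by move=> ip; apply: chart_smooth_pderivable; last exact: vf_smooth. Qed.

Lemma lower_derivable (v : vector_field M) i p h :
  at_chart i p -> pderivable i (fun q => lower g v i q h) p.
Proof.
move=> ip; apply: pderivable_sum => k.
by apply: pderivableM; [exact: g_derivable | exact: vf_derivable].
Qed.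

(** The equation g x = g y can be solved because g is nondegenerate; this
    replaces raising an index with the inverse metric. *)
Lemma metric_inj i p (x y : 'I_n -> R) : at_chart i p ->
  (forall h, \sum_k g i p h k * x k = \sum_k g i p h k * y k) -> x =1 y.
Proof.
move=> ip gxy k.
have mxE z h : \sum_k g i p h k * z k = (g i p *m \col_k z k) h 0.
  by rewrite mxE; apply: eq_bigr => j _; rewrite mxE.
have : \col_k x k = \col_k y k.
  apply: (can_inj (mulKmx (metric_unitmx g ip))).
  by apply/matrixP => h j; rewrite !ord1 -!mxE.
by move/matrixP/(_ k 0); rewrite !matrix.mxE.
Qed.

Lemma metric_neq0 i p : (0 < n)%N -> at_chart i p -> exists h k, g i p h k != 0.
Proof.
move=> n_gt0 ip; apply: contrapT => g_zero.
have g0 h k : g i p h k = 0.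
  by apply/eqP; apply: contrapT => /negP ghk; apply: g_zero; exists h, k.
have /(_ (Ordinal n_gt0)) /eqP : (fun=> 1) =1 (fun=> 0 : R) :> ('I_n -> R).
  by apply: (metric_inj ip) => h; apply: eq_bigr => k _; rewrite g0 !mul0r.
by rewrite oner_eq0.
Qed.

Lemma unit_timelike_sqnorm (v : vector_field M) i p : at_chart i p ->
  unit_timelike g v -> \sum_e lower g v i p e * v i p e = -1.
Proof. by move=> ip /(_ _ _ ip). Qed.

Section MetricConnection.
Variable G : index M -> M -> 'I_n -> 'I_n -> 'I_n -> R.
Hypothesis Gg : metric_compatible G g.

Lemma pd_metric i p k a b : at_chart i p ->
  pd i k (fun q => g i q a b) p =
  \sum_c g i p b c * G i p c k a + \sum_c g i p a c * G i p c k b.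
Proof.
move=> ip; have /eqP := Gg k a b ip; rewrite -addrA -opprD subr_eq0 => /eqP ->.
congr (_ + _); apply: eq_bigr => c _; last by rewrite mulrC.
by rewrite mulrC g_sym.
Qed.

(** Lowering an index commutes with a covariant derivative that kills g. *)
Lemma cov_deriv_lower (u : vector_field M) i p k h : at_chart i p ->
  cov_deriv G (lower g u) i p k h =
  \sum_a g i p h a *
    (pd i k (fun q => u i q a) p + \sum_e G i p a k e * u i p e).
Proof.
move=> ip; rewrite /cov_deriv /lower pd_sum => [|a]; last first.
  by apply: pderivableM; [exact: g_derivable | exact: vf_derivable].
pose du := \sum_a g i p h a * pd i k (fun q => u i q a) p.
pose Gh := \sum_a \sum_c g i p a c * G i p c k h * u i p a.
pose Gu := \sum_a \sum_c g i p h c * G i p c k a * u i p a.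
transitivity ((Gh + Gu + du) - Gh).
  congr (_ - _).
    rewrite -!big_split; apply: eq_bigr => a _ /=.
    rewrite pdM//; [|exact: g_derivable|exact: vf_derivable].
    by rewrite pd_metric// mulrDl !mulr_suml.
  rewrite /Gh exchange_big; apply: eq_bigr => a _ /=; rewrite mulr_sumr.
  by apply: eq_bigr => c _; rewrite (g_sym g c a ip); ring.
have -> : Gh + Gu + du - Gh = du + Gu by ring.
rewrite /Gu exchange_big -big_split; apply: eq_bigr => a _ /=.
by rewrite mulrDr mulr_sumr; congr (_ + _); apply: eq_bigr => e _; rewrite mulrA.
Qed.

(** For a unit vector field the differential of the constant g(u, u) leaves
    no room for f: contracting d g(u, u) = 2 (f u_k - omega_k) = 0 with u
    kills f, and then omega with it. *)
Lemma unit_torqued_parallel (u : vector_field M) (f : R) (omega : 'I_n -> R) i p :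
  at_chart i p -> unit_timelike g u ->
  (forall k h, cov_deriv G (lower g u) i p k h =
               f * g i p k h + omega k * lower g u i p h) ->
  \sum_k omega k * u i p k = 0 ->
  forall k h, cov_deriv G (lower g u) i p k h = 0.
Proof.
move=> ip u1 tq ou0.
have u1p := unit_timelike_sqnorm ip u1.
have du k a : pd i k (fun q => u i q a) p + \sum_e G i p a k e * u i p e =
    f * (a == k)%:R + omega k * u i p a.
  move: a; apply: (metric_inj ip) => h; rewrite -cov_deriv_lower// tq.
  under [RHS]eq_bigr do rewrite mulrDr.
  rewrite big_split /= mulr_sumr; congr (_ + _).
    under eq_bigr do rewrite mulrA.
    by rewrite sum_delta (g_sym g h k ip) mulrC.
  by apply: eq_bigr => a _; rewrite mulrCA.
have omegaE k : omega k = f * lower g u i p k.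
  have : pd i k (fun q => \sum_h lower g u i q h * u i q h) p = 0.
    rewrite (@pd_ext _ _ _ _ _ _ (fun=> -1)) ?pd_cst// => q iq.
    exact: unit_timelike_sqnorm.
  rewrite pd_sum => [|a]; last first.
    by apply: pderivableM; [exact: lower_derivable | exact: vf_derivable].
  rewrite (eq_bigr (fun h =>
      \sum_a G i p a k h * lower g u i p a * u i p h -
      \sum_e lower g u i p h * (G i p h k e * u i p e) +
      (f * (g i p k h * u i p h) + f * (lower g u i p h * (h == k)%:R) +
       2 * omega k * (lower g u i p h * u i p h)))) => [|h _]; last first.
    rewrite pdM//; [|exact: lower_derivable|exact: vf_derivable].
    have /eqP := tq k h; rewrite /cov_deriv subr_eq => /eqP ->.
    have /eqP := du k h; rewrite eq_sym -subr_eq => /eqP <-.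
    rewrite -mulr_suml -mulr_sumr; ring.
  rewrite !big_split /= sumrN exchange_big /=.
  rewrite -!mulr_sumr sum_delta u1p -/(lower g u i p k).
  set A := \sum_a \sum_c _; set B := \sum_a \sum_c _.
  have -> : A = B.
    by apply: eq_bigr => a _; apply: eq_bigr => e _; ring.
  rewrite subrr add0r => omega2.
  have : 2 * (f * lower g u i p k - omega k) = 0 by rewrite -omega2; ring.
  by move/eqP; rewrite mulf_eq0 pnatr_eq0 subr_eq0 => /eqP.
have f0 : f = 0.
  move: ou0; under eq_bigr do rewrite omegaE -mulrA.
  by rewrite -mulr_sumr u1p mulrN1 => /eqP; rewrite oppr_eq0 => /eqP.
by move=> k h; rewrite tq omegaE f0 !mul0r addr0.
Qed.

End MetricConnection.

End Metric.

(** * The Levi-Civita connection of a semi-symmetric metric connection *)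

Section SemiSymmetric.
Variables (R : realType) (n : nat) (M : spacetime R n).
Variables (nabla : linear_connection M) (v : vector_field M).
Hypothesis ssm : semi_symmetric_metric nabla v.
Implicit Types (i : index M) (p : M) (a b c d e h k : 'I_n).

Local Notation g := (metric M).
Local Notation pi := (lower g v).

Let nabla_metric : metric_compatible nabla g. Proof. by case: ssm. Qed.

(** The components of (X, Y) |-> pi(Y) X - g(X, Y) v. *)
Definition contorsion i p a b c : R :=
  pi i p c * (a == b)%:R - g i p b c * v i p a.

(** By uniqueness of the Levi-Civita connection it suffices that subtracting
    the contorsion removes the torsion and adds
    pi_a g_bk - g_ka pi_b + pi_b g_ak - g_kb pi_a = 0 to the derivative of g. *)
Lemma levi_civita_semi_symmetric i p a b c : at_chart i p ->
  levi_civita g i p a b c = nabla i p a b c - contorsion i p a b c.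
Proof.
have [mc tor] := ssm; move=> ip; apply/esym; move: i p a b c ip.
apply/levi_civitaP; split=> [i p a b c ip|i p k a b ip].
  have := tor i p a b c ip.
  rewrite /torsion /contorsion (g_sym g c b ip) => torE.
  transitivity (nabla i p a b c - nabla i p a c b -
    (pi i p c * (a == b)%:R - pi i p b * (a == c)%:R)); first by ring.
  by rewrite torE subrr.
have gcont x y : \sum_c contorsion i p c k x * g i p y c =
    pi i p x * g i p y k - g i p k x * pi i p y.
  transitivity (\sum_c (pi i p x * (g i p y c * (c == k)%:R) -
      g i p k x * (g i p y c * v i p c))).
    by apply: eq_bigr => c _; rewrite /contorsion; ring.
  by rewrite sumrB -!mulr_sumr sum_delta.
have sumB x y : \sum_c (nabla i p c k x - contorsion i p c k x) * g i p y c =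
    \sum_c g i p y c * nabla i p c k x -
    (pi i p x * g i p y k - g i p k x * pi i p y).
  rewrite -gcont -sumrB; apply: eq_bigr => c _; ring.
rewrite (eq_bigr (fun c =>
  (nabla i p c k a - contorsion i p c k a) * g i p b c)) => [|c _]; last first.
  by rewrite (g_sym g c b ip).
rewrite !sumB (pd_metric mc)// (g_sym g k a ip) (g_sym g k b ip); ring.
Qed.

(** ** The case of a parallel unit field *)

Section Parallel.
Variables (i : index M) (p : M).
Hypotheses (ip : at_chart i p) (v1 : unit_timelike g v).
Hypothesis v_parallel : forall k h, cov_deriv nabla pi i p k h = 0.

Local Notation G := (nabla i p).

Let dpi c b := \sum_e G e c b * pi i p e.
Let gG b c d := \sum_e g i p b e * G e c d.
Let Gv a c := \sum_e G a c e * v i p e.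

Lemma contorsion_derivable a d b :
  pderivable i (fun q => contorsion i q a d b) p.
Proof.
apply: pderivableB; apply: pderivableM.
- exact: lower_derivable.
- exact: pderivable_cst.
- exact: g_derivable.
- exact: vf_derivable.
Qed.

(** As v and g are parallel, their derivatives are contractions with the
    coefficients of nabla; this makes the curvature of D algebraic in those
    coefficients, up to the curvature of nabla itself. *)
Lemma pd_contorsion a b c d :
  pd i c (fun q => contorsion i q a d b) p =
  dpi c b * (a == d)%:R - (gG b c d + gG d c b) * v i p a + g i p d b * Gv a c.
Proof.
have dvE : pd i c (fun q => v i q a) p = - Gv a c.
  apply/eqP; rewrite -addr_eq0; apply/eqP; move: a.
  apply: (metric_inj (g := g) ip (y := fun=> 0)) => h.
  rewrite [RHS]big1 => [|k _]; last exact: mulr0.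
  exact: etrans (esym (cov_deriv_lower nabla_metric v c h ip)) (v_parallel c h).
have dpiE : pd i c (fun q => pi i q b) p = dpi c b.
  by apply/eqP; rewrite -subr_eq0; apply/eqP; exact: v_parallel.
have dg : pderivable i (fun q => g i q d b) p by exact: g_derivable.
have dv : pderivable i (fun q => v i q a) p by exact: vf_derivable.
have dl : pderivable i (fun q => pi i q b) p by exact: lower_derivable.
have d1 := @pderivable_cst R n M i (a == d)%:R p.
rewrite pdB; [|exact: pderivableM|exact: pderivableM].
rewrite !pdM// pd_cst dvE dpiE (pd_metric nabla_metric)// -/(gG b c d) -/(gG d c b); ring.
Qed.

Lemma levi_civita_mul a b c d :
  \sum_e levi_civita g i p a c e * levi_civita g i p e d b =
  \sum_e G a c e * G e d b - (pi i p b * G a c d - g i p d b * Gv a c)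
  - ((a == c)%:R * dpi d b - v i p a * gG c d b)
  + ((a == c)%:R * (pi i p b * pi i p d + g i p d b)
     - v i p a * (pi i p b * g i p c d - g i p d b * pi i p c)).
Proof.
pose l := pi i p; pose w := v i p; pose g' := g i p.
transitivity (\sum_e (G a c e * G e d b -
    (l b * (G a c e * (e == d)%:R) - g' d b * (G a c e * w e)) -
    ((a == c)%:R * (G e d b * l e) - w a * (g' c e * G e d b)) +
    ((a == c)%:R * (l b * (l e * (e == d)%:R) - g' d b * (l e * w e)) -
     w a * (l b * (g' c e * (e == d)%:R) - g' d b * (g' c e * w e))))).
  apply: eq_bigr => e _; rewrite !levi_civita_semi_symmetric// /contorsion.
  rewrite /l /w /g'; ring.
rewrite big_split /= !(sumrB, =^~ mulr_sumr) !sum_delta.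
rewrite (unit_timelike_sqnorm ip v1) mulrN1 opprK.
by rewrite -/(Gv a c) -/(dpi d b) -/(gG c d b) -/(lower g v i p c).
Qed.

(** Up to terms symmetric in c and d, the difference of the two curvatures
    involves the connection only through its torsion, which is known; the
    terms in v then cancel. *)
Lemma curvature_levi_civita_parallel a b c d :
  curvature (levi_civita g) i p a b c d =
  curvature nabla i p a b c d +
  ((a == c)%:R * g i p d b - (a == d)%:R * g i p c b).
Proof.
have tor x : G x c d = G x d c + pi i p d * (x == c)%:R - pi i p c * (x == d)%:R.
  have [_ /(_ i p x c d ip)] := ssm; rewrite /torsion => /eqP.
  by rewrite subr_eq addrC addrA => /eqP.
have gG_tor : gG b c d = gG b d c + pi i p d * g i p b c - pi i p c * g i p b d.
  rewrite -[g i p b c]sum_delta -[g i p b d]sum_delta !mulr_sumr.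
  rewrite -big_split -sumrB; apply: eq_bigr => e _ /=; rewrite tor; ring.
have pdL x y z t : pd i x (fun q => levi_civita g i q y z t) p =
    pd i x (fun q => nabla i q y z t) p -
    pd i x (fun q => contorsion i q y z t) p.
  rewrite -pdB; last exact: contorsion_derivable.
    by apply: pd_ext => // q iq; exact: levi_civita_semi_symmetric.
  by apply: chart_smooth_pderivable; last exact: lc_smooth.
rewrite /curvature !sumrB !levi_civita_mul !pdL !pd_contorsion gG_tor tor.
rewrite (g_sym g b c ip) (g_sym g b d ip) (g_sym g d c ip); ring.
Qed.

Lemma ricci_levi_civita_parallel b d :
  (forall a c, curvature nabla i p a b c d = 0) ->
  ricci (levi_civita g) i p b d = (n%:R - 1) * g i p b d.
Proof.
move=> flat_p; rewrite /ricci (eq_bigr (fun a =>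
    g i p d b - g i p b a * (a == d)%:R)) => [|a _]; last first.
  rewrite curvature_levi_civita_parallel flat_p eqxx (g_sym g a b ip) /= mulr1n; ring.
rewrite sumrB sum_delta sumr_const card_ord (g_sym g d b ip) -mulr_natl; ring.
Qed.

End Parallel.
End SemiSymmetric.

Theorem theorem1p6 (R : realType) (n : nat) (n_ge3 : (3 <= n)%N)
    (M : spacetime R n) (nabla : linear_connection M) (v : vector_field M)
    (nabla_ssm : semi_symmetric_metric nabla v)
    (v_unit : unit_timelike (metric M) v)
    (nabla_flat : flat nabla)
    (v_torqued : torqued nabla v) :
  perfect_fluid M.
Proof.
have ricciE i p h k : at_chart i p ->
    ricci (levi_civita (metric M)) i p h k = (n%:R - 1) * metric M i p h k.
  move=> ip; have [f [omega [tq omega_v]]] := v_torqued.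
  apply: (ricci_levi_civita_parallel nabla_ssm ip v_unit) => [k' h'|a c].
    exact: (unit_torqued_parallel nabla_ssm.1 ip v_unit
      (fun x y => tq i p x y ip) (omega_v i p ip)).
  exact: nabla_flat.
split=> [i p ip|].
  have [|h [k ghk]] := metric_neq0 (metric M) _ ip.
    exact: leq_trans n_ge3.
  exists h, k; rewrite ricciE// mulf_neq0// subr_eq0 pnatr_eq1.
  by rewrite gtn_eqF// (leq_trans _ n_ge3).
exists (fun=> n%:R - 1), (fun=> 0), v; split=> //; try exact: smooth_cst.
by move=> i p h k ip; rewrite ricciE// !mul0r addr0.
Qed.
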